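(* Let $M$ and $N$ be nonzero proper subspaces of $\mathbb{C}^n$, let $P_M,P_N$ be the orthogonal projections onto $M$ and $N$, and let $\theta_1$ and $\eta_1$ be the Dixmier angles between $M$ and $N$ and between $M^{\perp}$ and $N^{\perp}$, respectively. Then $$W(P_M+P_N)=\left[2\sin^2\frac{\eta_1}{2},\ 2\cos^2\frac{\theta_1}{2}\right]\quad\text{and}\quad w(P_M+P_N)=2\cos^2\frac{\theta_1}{2}.$$
   Context: The numerical range of an operator $A$ on $\mathbb{C}^n$ is $W(A)=\{\langle Ax,x\rangle: x\in\mathbb{C}^n,\ \|x\|=1\}$ and its numerical radius is $w(A)=\sup\{|\lambda|:\lambda\in W(A)\}$. The Dixmier angle between two nonzero subspaces $M,N$ (the smallest principal angle) is the number $\alpha_0(M,N)\in[0,\pi/2]$ with $\cos\alpha_0(M,N)=\sup\{|\langle u,v\rangle|: u\in M,\ v\in N,\ \|u\|=\|v\|=1\}$. *)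

(* Defs.v *)
From HB Require Import structures.
From mathcomp Require Import all_boot all_order all_algebra sesquilinear spectral.
From mathcomp Require Import complex.
From mathcomp Require Import all_classical all_reals trigo.

Set Implicit Arguments.
Unset Strict Implicit.
Unset Printing Implicit Defensive.

Import Order.TTheory GRing.Theory Num.Theory.
Local Open Scope ring_scope.
Local Open Scope complex_scope.
Local Open Scope classical_set_scope.

(* Conventions: vectors of C^n are rows over R[i], with the Hermitian product
   [dotmx u v] (linear in u, conjugate-linear in v). An operator is a matrix A
   acting by x |-> x *m A, and a subspace is the row space of a matrix, so
   [(u <= M)%MS] means that u belongs to M. *)

Notation "M ^!" :=
  (orthomx Num.conj (mx_of_hermitian (hermitian1mx _)) M) : matrix_set_scope.

Section Defs.
Variables (R : realType) (n : nat).
Implicit Types (A M N : 'M[R[i]]_n) (u v x : 'rV[R[i]]_n).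

Definition enorm x : R[i] := sqrtC (dotmx x x).

Definition numerical_range A : set R[i] :=
  [set dotmx (x *m A) x | x in [set x | enorm x = 1]].

(* [normc] is the modulus with values in R; `|z| takes its values in R[i]. *)
Definition numerical_radius A : R :=
  sup [set ComplexField.Normc.normc z | z in numerical_range A].

Definition unit_dots M N : set R :=
  [set r | exists u v, [/\ (u <= M)%MS, (v <= N)%MS,
    enorm u = 1, enorm v = 1 & r = ComplexField.Normc.normc (dotmx u v)]].

(* [dixmier_angleP] below: for nonzero M and N this is the element of
   [0, pi / 2] whose cosine is [sup (unit_dots M N)]. *)
Definition dixmier_angle M N : R := acos (sup (unit_dots M N)).

Lemma enorm1 x : enorm x = 1 -> dotmx x x = 1.
Proof. by rewrite /enorm => h; rewrite -[LHS]sqrtCK h expr1n. Qed.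

Lemma ex_unit M : M != 0 -> exists2 u, (u <= M)%MS & enorm u = 1.
Proof.
move=> /rowV0Pn[u uM u0]; pose c := (sqrtC (dotmx u u))^-1.
have e0 : sqrtC (dotmx u u) != 0 by rewrite sqrtC_eq0 dnorm_eq0.
exists (c *: u); first exact: scalemx_sub.
rewrite /enorm dnormZ normfV ger0_norm ?sqrtC_ge0 ?dnorm_ge0 //.
by rewrite exprVn sqrtCK mulVf ?dnorm_eq0 // rootC1.
Qed.

Lemma dot_le1 u v : enorm u = 1 -> enorm v = 1 ->
  ComplexField.Normc.normc (dotmx u v) <= 1.
Proof.
move=> /enorm1 hu /enorm1 hv.
have [+ _] := CauchySchwarz (@dotmx R[i] n) u v.
rewrite /= hu hv mulr1 expr_le1 //.
by rewrite /Num.norm /= lecR.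
Qed.

Lemma dixmier_angleP M N (a : R) : M != 0 -> N != 0 ->
  a = dixmier_angle M N <->
  0 <= a <= pi / 2%:R /\ cos a = sup (unit_dots M N).
Proof.
move=> /ex_unit[u uM u1] /ex_unit[v vN v1].
pose r := ComplexField.Normc.normc (dotmx u v).
have Sr : unit_dots M N r by exists u, v.
have ub1 : ubound (unit_dots M N) 1.
  by move=> _ [x [y [_ _ x1 y1 ->]]]; exact: dot_le1.
have s1 : sup (unit_dots M N) <= 1 by apply: ge_sup => //; exists r.
have s0 : 0 <= sup (unit_dots M N).
  apply: (@le_trans _ _ r); last by apply: ub_le_sup => //; exists 1.
  by rewrite /r; case: (dotmx u v) => p q /=; rewrite sqrtr_ge0.
have sI : -1 <= sup (unit_dots M N) <= 1.
  by rewrite s1 andbT (le_trans _ s0) // lerN10.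
have pi0 : 0 <= pi :> R := pi_ge0 R.
have pi2 : pi / 2%:R <= pi :> R by rewrite ler_pdivrMr // ler_peMr // ler1n.
have pi20 : 0 <= pi / 2%:R :> R by rewrite divr_ge0.
split=> [->|[/andP[a0 api] ca]].
  rewrite /dixmier_angle; have [/andP[b0 bpi] cb] := acos_def sI.
  split=> //; rewrite b0 /= leNgt; apply/negP => lt.
  have : cos (acos (sup (unit_dots M N))) < cos (pi / 2%:R).
    by rewrite ltr_cos // in_itv /= ?pi20 ?pi2 ?b0.
  by rewrite cos_pihalf cb ltNge s0.
by rewrite /dixmier_angle -ca cosK // in_itv /= a0 (le_trans api).
Qed.

End Defs.

(* Main.v *)
Require Import Defs.
From mathcomp Require Import all_boot all_order all_algebra sesquilinear spectral.
From mathcomp Require Import complex.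
From mathcomp Require Import all_classical all_reals real_interval trigo lra.

(** Write P, Q for the projections onto M, N and A = P + Q. The matrix A is
Hermitian, so its numerical range is the segment spanned by its extreme
eigenvalues; this is read off an orthonormal eigenbasis
([numerical_range_hermitian]). Only the two endpoints have to be computed.

The upper endpoint is 1 + s, where s = cos theta1 is the supremum of |<u, v>|
over unit vectors u of M and v of N ([numerical_range_max]):
- for a unit vector x put p = xP, q = xQ and r = <xA, x> = |p|^2 + |q|^2; the
  Cauchy-Schwarz inequality gives
    r^2 <= |p + q|^2 = r + 2 Re <p, q> <= r + 2 s |p| |q| <= r + s r,
  hence r <= 1 + s ([rayleigh_proj_sum_le]);
- given unit vectors u of M and v of N, rotate u so that <u, v> = c >= 0; then
  x = u + v has |x|^2 = 2 (1 + c), while |xP| >= <x, u> = 1 + c and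
  |xQ| >= <x, v> = 1 + c, so the Rayleigh quotient of A at x is at least 1 + c
  ([rayleigh_proj_sum_ge]).

The projections onto the orthogonal complements of M and N sum to 2 - A, whose
numerical range has upper endpoint 1 + cos eta1 by the same argument; so the
lower endpoint for A is 1 - cos eta1. It is nonnegative, whence the numerical
radius, and the half-angle formulas give the form stated. *)

Set Implicit Arguments.
Unset Strict Implicit.
Unset Printing Implicit Defensive.

Import Order.TTheory GRing.Theory Num.Theory.
Local Open Scope ring_scope.
Local Open Scope complex_scope.
Local Open Scope classical_set_scope.

(** * Rayleigh quotients of a sum of two orthogonal projections *)

Section InnerProduct.
Variables (C : numClosedFieldType) (n : nat).
Implicit Types (u v x y : 'rV[C]_n) (A M N : 'M[C]_n).

Local Notation "''[' u , v ]" := (dotmx u%R v%R) : ring_scope.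
Local Notation "''[' u ]" := '[u, u]%R : ring_scope.

Lemma dotmxC u v : '[u, v] = Num.conj '[v, u].
Proof. by rewrite [LHS]hermC expr0 mul1r. Qed.

Lemma dotmx_ortho p q (U : 'M[C]_(p, n)) (V : 'M[C]_(q, n)) u v :
  (U <= V^!)%MS -> (u <= U)%MS -> (v <= V)%MS -> '[u, v] = 0.
Proof. by move=> /orthomxP UV uU vV; apply/hermmx_eq0P/UV. Qed.

Lemma normalizeE x : x != 0 -> exists2 y, '[y] = 1 & x = sqrtC '[x] *: y.
Proof.
move=> x0; have s0 : sqrtC '[x] != 0 by rewrite sqrtC_eq0 dnorm_eq0.
exists ((sqrtC '[x])^-1 *: x); last by rewrite scalerA divff // scale1r.
rewrite dnormZ normfV ger0_norm ?sqrtC_ge0 ?dnorm_ge0 // exprVn sqrtCK.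
by rewrite mulVf ?dnorm_eq0.
Qed.

Lemma unit_rescale A x : x != 0 ->
  exists2 y, '[y] = 1 & '[y *m A, y] * '[x] = '[x *m A, x].
Proof.
move=> /normalizeE[y y1 xE]; exists y => //; rewrite [in RHS]xE.
rewrite -scalemxAl linearZl_LR linearZr_LR /= mulrA -normCK.
by rewrite ger0_norm ?sqrtC_ge0 ?dnorm_ge0 // sqrtCK mulrC.
Qed.

Lemma proj_ortho_selfadjoint p (U : 'M[C]_(p, n)) x y :
  '[x *m proj_ortho U, y] = '[x, y *m proj_ortho U].
Proof.
(* the part of b orthogonal to U does not contribute to the product *)
have key a b :
    '[a *m proj_ortho U, b] = '[a *m proj_ortho U, b *m proj_ortho U].
  rewrite -{1}[b](add_proj_ortho U b) linearDr /=.
  rewrite [X in _ + X](@dotmx_ortho _ _ U U^!%MS) ?addr0 //.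
  - by rewrite ortho_id.
  - exact: proj_ortho_sub.
  - exact: proj_ortho_sub.
by rewrite key dotmxC -key -dotmxC.
Qed.

Lemma dnorm_proj_ortho p (U : 'M[C]_(p, n)) x :
  '[x *m proj_ortho U, x] = '[x *m proj_ortho U].
Proof. by rewrite -[RHS]proj_ortho_selfadjoint -mulmxA proj_ortho_proj. Qed.

Lemma dnorm_proj_sum M N x :
  '[x *m (proj_ortho M + proj_ortho N), x] =
    '[x *m proj_ortho M] + '[x *m proj_ortho N].
Proof. by rewrite mulmxDr linearDl /= !dnorm_proj_ortho. Qed.

Lemma selfadjoint_hermsymmx A :
  (forall x y, '[x *m A, y] = '[x, y *m A]) -> A \is hermsymmx.
Proof.
move=> sA; apply/is_hermitianmxP; rewrite expr0 scale1r.
apply/matrixP => i j; rewrite !mxE.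
have E x k : '[x, delta_mx 0 k] = x 0 k.
  rewrite dotmxE mxE (bigD1 k) //= !mxE !eqxx conjC1 mulr1.
  rewrite big1 ?addr0 // => l lk.
  by rewrite !mxE (negPf lk) andbF conjC0 mulr0.
have := sA (delta_mx 0 i) (delta_mx 0 j).
by rewrite E [RHS]dotmxC E -!rowE !mxE.
Qed.

Lemma proj_sum_hermsymmx M N : proj_ortho M + proj_ortho N \is hermsymmx.
Proof.
apply: selfadjoint_hermsymmx => x y.
by rewrite !mulmxDr linearDl linearDr /= !proj_ortho_selfadjoint.
Qed.

Lemma addCJ_le_norm (d : C) : d + Num.conj d <= 2 * `|d|.
Proof.
by rewrite -ler_pdivrMl ?ltr0n // mulrC -[X in X <= _]ReE leif_Re_Creal.
Qed.

(** Writing r for the Rayleigh quotient <xA, x>, the bound comes from squeezing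
|xA|^2 between r^2 and r (1 + s). The hypothesis speaks of vectors of any length
because it is applied to xP and xQ, which may vanish. *)
Lemma rayleigh_proj_sum_le M N (s : C) : 0 <= s ->
    (forall u v, (u <= M)%MS -> (v <= N)%MS ->
      `|'[u, v]| <= s * (sqrtC '[u] * sqrtC '[v])) ->
  forall x, '[x] = 1 ->
    '[x *m (proj_ortho M + proj_ortho N), x] <= 1 + s.
Proof.
move=> s0 hs x x1; set A := _ + _; pose r := '[x *m A, x].
set p := x *m proj_ortho M; set q := x *m proj_ortho N.
have rE : r = '[p] + '[q] by exact: dnorm_proj_sum.
have r0 : 0 <= r by rewrite rE addr_ge0 ?dnorm_ge0.
have : r ^+ 2 <= r * (1 + s).
  have [CS _] := CauchySchwarz (@dotmx C n) (x *m A) x.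
  rewrite /= x1 mulr1 -/r ger0_norm // in CS; apply: (le_trans CS).
  rewrite [x *m A]mulmxDr -/p -/q dnormD /= -rE mulrDr mulr1 lerD2l.
  apply: (le_trans (addCJ_le_norm _)).
  apply: (@le_trans _ _ (2 * (s * (sqrtC '[p] * sqrtC '[q])))).
    by rewrite ler_pM2l ?ltr0n // hs // proj_ortho_sub.
  rewrite mulrCA [leRHS]mulrC ler_wpM2l // rE.
  rewrite -[X in _ <= X + _]sqrtCK -[X in _ <= _ + X]sqrtCK mulr_natl.
  by rewrite real_leif_mean_square_scaled // ger0_real // sqrtC_ge0 dnorm_ge0.
rewrite -/r; have [->|rn0] := eqVneq r 0; first by rewrite addr_ge0.
by rewrite expr2 ler_pM2l // lt_def rn0.
Qed.

Lemma unit_phase (d : C) : exists2 e : C, `|e| = 1 & e * d = `|d|.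
Proof.
have [->|d0] := eqVneq d 0; first by exists 1; rewrite ?normr1 ?mulr0 ?normr0.
exists (Num.conj d / `|d|).
  by rewrite normrM normfV normr_id norm_conjC divff ?normr_eq0.
by rewrite mulrAC [_ * d]mulrC -normCK expr2 mulfK ?normr_eq0.
Qed.

(** The test vector is the bisector of v and the rotation of u that makes the
product real: both projections of the bisector are at least as long as its
component along the corresponding unit vector. *)
Lemma rayleigh_proj_sum_ge M N u v :
    (u <= M)%MS -> (v <= N)%MS -> '[u] = 1 -> '[v] = 1 ->
  exists2 x, '[x] = 1 &
    1 + `|'[u, v]| <= '[x *m (proj_ortho M + proj_ortho N), x].
Proof.
move=> uM vN u1 v1; have [e e1 ec] := unit_phase '[u, v].
pose c := `|'[u, v]|; have c0 : 0 <= c by exact: normr_ge0.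
have c1 : 0 < 1 + c by rewrite ltr_wpDr.
pose w := e *: u; have wM : (w <= M)%MS by exact: scalemx_sub.
have w1 : '[w] = 1 by rewrite dnormZ e1 expr1n mul1r.
have wv : '[w, v] = c by rewrite linearZl_LR.
have vw : '[v, w] = c by rewrite dotmxC wv (CrealP _) ?ger0_real.
have X : '[w + v] = 2 * (1 + c).
  rewrite dnormD /= wv w1 v1 (CrealP (ger0_real c0)).
  by rewrite mulr_natl mulr2n addrACA.
have bound (U : 'M_n) z : (z <= U)%MS -> '[z] = 1 -> '[w + v, z] = 1 + c ->
    (1 + c) ^+ 2 <= '[(w + v) *m proj_ortho U].
  move=> zU z1 E.
  have [+ _] := CauchySchwarz (@dotmx C n) ((w + v) *m proj_ortho U) z.
  rewrite /= z1 mulr1 proj_ortho_selfadjoint (proj_ortho_id zU) E.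
  by rewrite gtr0_norm.
have x0 : w + v != 0
  by rewrite -(dnorm_eq0 (@dotmx C n)) /= X mulf_neq0 ?pnatr_eq0 ?gt_eqF.
have [x x1 xE] := unit_rescale (proj_ortho M + proj_ortho N) x0.
exists x => //; rewrite -(@ler_pM2r _ '[w + v]); last by rewrite dnorm_gt0.
rewrite xE X dnorm_proj_sum mulrCA -expr2 mulr_natl mulr2n lerD //.
  by apply: (bound M w) => //; rewrite linearDl /= w1 vw.
by apply: (bound N v) => //; rewrite linearDl /= wv v1 addrC.
Qed.

Lemma ortho_neq0 M : (M < (1%:M : 'M[C]_n))%MS -> (M^!)%MS != 0.
Proof.
rewrite ltmxErank mxrank1 => /andP[_].
by rewrite -mxrank_eq0 rank_ortho -lt0n subn_gt0.
Qed.

Lemma proj_ortho_compl M : proj_ortho M^!%MS = 1%:M - proj_ortho M.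
Proof.
apply/eqP; rewrite eq_sym subr_eq addrC.
by have := add_proj_ortho M 1%:M; rewrite !mul1mx => ->.
Qed.

(** Passing to complements turns A into 2 - A, hence minima into maxima. *)
Lemma rayleigh_proj_ortho_compl M N x : '[x] = 1 ->
  '[x *m (proj_ortho M^!%MS + proj_ortho N^!%MS), x] =
    2 - '[x *m (proj_ortho M + proj_ortho N), x].
Proof.
move=> x1; have -> : x *m (proj_ortho M^!%MS + proj_ortho N^!%MS) =
    x + x - x *m (proj_ortho M + proj_ortho N).
  by rewrite !proj_ortho_compl addrACA -opprD mulmxBr mulmxDr mulmx1.
by rewrite linearBl /= linearDl /= x1.
Qed.

(** The spectral theorem in coordinates: the rows of the unitary matrix that
diagonalises A are the eigenvectors. *)
Lemma hermitian_eigenbasis A : A \is hermsymmx ->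
  exists (e : 'I_n -> 'rV[C]_n) (d : 'I_n -> C),
    [/\ forall i, d i \is Num.real,
        forall i j, '[e i, e j] = (i == j)%:R,
        forall i, e i *m A = d i *: e i,
        forall x, '[x] = \sum_i `|'[x, e i]| ^+ 2 &
        forall x, '[x *m A, x] = \sum_i d i * `|'[x, e i]| ^+ 2].
Proof.
move=> hA; have /orthomx_spectralP AE := hermitian_normalmx hA.
have dR := hermitian_spectral_diag_real hA.
have PU := spectral_unitarymx A.
move: (spectralmx A) (spectral_diag A) AE dR PU => P d AE dR PU.
have PE := invmx_unitary PU; have Pu := unitarymx_unit PU.
have coord x i : (x *m invmx P) 0 i = '[x, row i P].
  by rewrite PE dotmxE !mxE; apply: eq_bigr => k _; rewrite !mxE.
have PtE : P = ((invmx P) ^t Num.conj)%sesqui by rewrite PE trmxCK.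
have conjE (y : 'rV_n) i : ((y ^t Num.conj)%sesqui) i 0 = Num.conj (y 0 i).
  by rewrite !mxE.
have normE x : '[x] = \sum_i `|'[x, row i P]| ^+ 2.
  have -> : '[x] = '[x *m invmx P].
    by rewrite !dotmxE trmx_mul map_mxM mulmxA -PtE mulmxKV.
  rewrite dotmxE mxE; apply: eq_bigr => i _.
  by rewrite conjE coord normCK.
exists (fun i => row i P), (fun i => d 0 i); split=> //.
- by move=> i; exact: (mxOverP dR).
- by move=> i j; apply/row_unitarymxP.
- move=> i; rewrite -row_mul AE -!mulmxA mulKVmx // row_mul.
  by rewrite row_diag_mx -scalemxAl -rowE.
- move=> x; have -> : '[x *m A, x] = '[x *m invmx P *m diag_mx d, x *m invmx P].
    by rewrite !dotmxE trmx_mul map_mxM [in RHS]mulmxA -PtE {1}AE !mulmxA.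
  rewrite dotmxE mxE; apply: eq_bigr => i _.
  by rewrite conjE mul_mx_diag mxE coord normCK mulrA [d 0 i * _]mulrC.
Qed.

End InnerProduct.

(** * Numerical ranges as real segments *)

Section RealRange.
Variables (R : realType) (n : nat).
Implicit Types (u v x y : 'rV[R[i]]_n) (A M N : 'M[R[i]]_n).

Local Notation "''[' u , v ]" := (dotmx u%R v%R) : ring_scope.
Local Notation "''[' u ]" := '[u, u]%R : ring_scope.

Lemma enormP x : enorm x = 1 <-> '[x] = 1.
Proof. by split=> [/enorm1//|x1]; rewrite /enorm x1 sqrtC1. Qed.

Lemma normc_norm (z : R[i]) : (ComplexField.Normc.normc z)%:C = `|z|.
Proof. by []. Qed.

(** A value of the quadratic form is an average of the eigenvalues, so it lies
between the extreme ones; conversely, unit combinations of the two extreme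
eigenvectors reach every value in between. *)
Lemma numerical_range_hermitian A : (0 < n)%N -> A \is hermsymmx ->
  exists a b : R, a <= b /\ numerical_range A = [set t%:C | t in `[a, b]].
Proof.
move=> n0 /hermitian_eigenbasis[e [d [dR eO eA nE qE]]].
pose r i := complex.Re (d i); have dE i : d i = (r i)%:C by rewrite RRe_real.
have [j _ /(_ _ isT) jmin] :=
  @Order.TotalTheory.arg_minP _ _ _ (Ordinal n0) xpredT r isT.
have [k _ /(_ _ isT) kmax0] :=
  @Order.TotalTheory.arg_maxP _ _ _ (Ordinal n0) xpredT r isT.
have kmax i : r i <= r k by exact: kmax0.
have wR x i : `|'[x, e i]| ^+ 2 \is Num.real by rewrite rpredX ?normr_real.
have dB i : d j <= d i <= d k.
  by rewrite !dE !lecR jmin kmax.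
exists (r j), (r k); split; first exact: kmax.
apply/seteqP; split=> [_ [x /= /enormP x1 <-]|_ [t /= + <-]].
  have qR : '[x *m A, x] \is Num.real.
    by rewrite qE rpred_sum // => i _; rewrite rpredM.
  exists (complex.Re '[x *m A, x]); last by rewrite RRe_real.
  have mE c : c = \sum_i c * `|'[x, e i]| ^+ 2.
    by rewrite -mulr_sumr -nE x1 mulr1.
  rewrite /= in_itv /= -!lecR !RRe_real // [d j]mE [d k]mE qE.
  apply/andP; split; apply: ler_sum => i _; rewrite ler_wpM2r ?exprn_ge0 //.
    by case/andP: (dB i).
  by case/andP: (dB i).
rewrite in_itv /= => /andP[jt tk].
have [jk|jk] := eqVneq (r j) (r k).
  exists (e j) => /=; first by apply/enormP; rewrite eO eqxx.
  rewrite eA linearZl_LR /= eO eqxx mulr1 dE.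
  by congr _%:C; apply/le_anti; rewrite jt jk tk.
have jNk : (j == k) = false by apply: contra_neqF jk => /eqP->.
have lt_jk : 0 < r k - r j by rewrite subr_gt0 lt_neqAle jk kmax.
(* weight of the top eigenvector for which the average of r j and r k is t *)
pose l := (t - r j) / (r k - r j).
have l0 : 0 <= l by rewrite divr_ge0 ?subr_ge0 // ltW.
have l1 : 0 <= 1 - l by rewrite subr_ge0 ler_pdivrMr // mul1r lerD2r.
have tE : l * r k + (1 - l) * r j = t.
  rewrite mulrBl mul1r addrCA addrC -mulrBr divfK ?gt_eqF //.
  by rewrite subrK.
pose p := (Num.sqrt l)%:C; pose q := (Num.sqrt (1 - l))%:C.
have pp : p * p = l%:C by rewrite -rmorphM /= -expr2 sqr_sqrtr.
have qq : q * q = (1 - l)%:C by rewrite -rmorphM /= -expr2 sqr_sqrtr.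
have pC : Num.conj p = p by apply/CrealP/complex_realP; eexists.
have qC : Num.conj q = q by apply/CrealP/complex_realP; eexists.
have dotE c c' : '[c *: e k + c' *: e j, p *: e k + q *: e j] = c * p + c' * q.
  rewrite linearDl !linearDr /= !linearZl_LR !linearZr_LR /= !eO !eqxx.
  by rewrite [k == j]eq_sym jNk pC qC !mulr0 !mulr1 addr0 add0r.
exists (p *: e k + q *: e j) => /=.
  by apply/enormP; rewrite dotE pp qq -rmorphD addrC subrK.
rewrite mulmxDl -!scalemxAl !eA !scalerA dotE.
by rewrite mulrAC pp mulrAC qq !dE -!rmorphM -rmorphD tE.
Qed.

Section UnitDots.
Variables M N : 'M[R[i]]_n.
Hypotheses (M0 : M != 0) (N0 : N != 0).

Let unit_dots_ubound : has_ubound (unit_dots M N).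
Proof. by exists 1 => _ [x [y [_ _ x1 y1 ->]]]; exact: dot_le1. Qed.

Let unit_dots_neq0 : unit_dots M N !=set0.
Proof.
have [[u uM u1] [v vN v1]] := (ex_unit M0, ex_unit N0).
by exists (ComplexField.Normc.normc '[u, v]), u, v.
Qed.

Let sup_unit_dots_ge0 : 0 <= sup (unit_dots M N).
Proof.
have [r Sr] := unit_dots_neq0; apply: (le_trans _ (ub_le_sup _ Sr)) => //.
by have [u [v [_ _ _ _ ->]]] := Sr; rewrite -ler0c normc_norm normr_ge0.
Qed.

(** By homogeneity, the supremum over unit vectors bounds the product of any two
vectors; [rayleigh_proj_sum_le] needs it in this form. *)
Lemma norm_dot_le_sup u v : (u <= M)%MS -> (v <= N)%MS ->
  `|'[u, v]| <= (sup (unit_dots M N))%:C * (sqrtC '[u] * sqrtC '[v]).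
Proof.
move=> uM vN.
have [->|u0] := eqVneq u 0.
  by rewrite !linear0l normr0 sqrtC0 mul0r mulr0.
have [->|v0] := eqVneq v 0.
  by rewrite !linear0r normr0 sqrtC0 !mulr0.
have [[u' u1 uE] [v' v1 vE]] := (normalizeE u0, normalizeE v0).
have s0 x : x != 0 -> sqrtC '[x] != 0 by rewrite sqrtC_eq0 dnorm_eq0.
have u'M : (u' <= M)%MS by rewrite -(eqmx_scale _ (s0 _ u0)) -uE.
have v'N : (v' <= N)%MS by rewrite -(eqmx_scale _ (s0 _ v0)) -vE.
rewrite {1}uE {1}vE linearZl_LR linearZr_LR /= !normrM norm_conjC.
rewrite !(ger0_norm (sqrt_dnorm_ge0 _ _)) mulrA [leRHS]mulrC.
rewrite ler_wpM2l ?mulr_ge0 ?sqrt_dnorm_ge0 // -normc_norm lecR.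
by apply: ub_le_sup => //; exists u', v'; split=> //; exact/enormP.
Qed.

Lemma cos_dixmier_angle : cos (dixmier_angle M N) = sup (unit_dots M N).
Proof. by case: ((dixmier_angleP (dixmier_angle M N) M0 N0).1 erefl). Qed.

(** The endpoint b is itself a value of the form, so the upper bound applies to
it; conversely b is at least 1 + |<u, v>| for all unit u of M and v of N, by
[rayleigh_proj_sum_ge]. *)
Lemma numerical_range_max (a b : R) : a <= b ->
    numerical_range (proj_ortho M + proj_ortho N) = [set t%:C | t in `[a, b]] ->
  b = 1 + cos (dixmier_angle M N).
Proof.
rewrite cos_dixmier_angle => ab WE; apply/le_anti/andP; split.
  have : numerical_range (proj_ortho M + proj_ortho N) b%:C.
    by rewrite WE; exists b => //=; rewrite in_itv /= ab lexx.
  move=> -[x /= /enormP x1 xE].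
  rewrite -lecR rmorphD /= -xE rayleigh_proj_sum_le ?ler0c //.
  exact: norm_dot_le_sup.
rewrite -lerBrDl; apply: ge_sup => // _
  [u [v [uM vN /enormP u1 /enormP v1 ->]]].
have [x x1 xge] := rayleigh_proj_sum_ge uM vN u1 v1.
rewrite lerBrDl -lecR rmorphD /= normc_norm (le_trans xge) //.
have : numerical_range (proj_ortho M + proj_ortho N)
    '[x *m (proj_ortho M + proj_ortho N), x] by exists x => //; exact/enormP.
by rewrite WE => -[t /= + <-]; rewrite in_itv lecR => /andP[].
Qed.

End UnitDots.

Lemma numerical_range_proj_ortho_compl M N (a b : R) :
    numerical_range (proj_ortho M + proj_ortho N) = [set t%:C | t in `[a, b]] ->
  numerical_range (proj_ortho M^!%MS + proj_ortho N^!%MS) =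
    [set t%:C | t in `[2 - b, 2 - a]].
Proof.
pose A := proj_ortho M + proj_ortho N; rewrite -/A => WE.
pose B := proj_ortho M^!%MS + proj_ortho N^!%MS; rewrite -/B.
have qE x : enorm x = 1 -> '[x *m B, x] = 2 - '[x *m A, x].
  by move=> /enormP; exact: rayleigh_proj_ortho_compl.
(* from here on only the relation [qE] between the two forms matters *)
move: A B WE qE => A B WE qE.
apply/seteqP; split=> [_ [x /= x1 <-]|_ [t /= + <-]].
  have : numerical_range A '[x *m A, x] by exists x.
  rewrite WE (qE _ x1) => -[t /=]; rewrite in_itv /= => /andP[at_ tb] <-.
  exists (2 - t); first by rewrite /= in_itv /= !lerD2l !lerN2 at_ tb.
  by rewrite rmorphB /= rmorph_nat.
rewrite in_itv /= => /andP[bt ta].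
have : numerical_range A (2 - t)%:C.
  by rewrite WE; exists (2 - t) => //=; rewrite in_itv /=; lra.
move=> -[x /= x1 xE]; exists x => //.
by rewrite (qE _ x1) xE rmorphB /= rmorph_nat opprB addrCA subrr addr0.
Qed.

Lemma numerical_radius_itv A (a b : R) : 0 <= a -> a <= b ->
  numerical_range A = [set t%:C | t in `[a, b]] -> numerical_radius A = b.
Proof.
move=> a0 ab WE; have normcE (t : R) : 0 <= t ->
    ComplexField.Normc.normc t%:C = t.
  by move=> t0; apply: (@complexI R); rewrite normc_norm ger0_norm ?ler0c.
rewrite /numerical_radius WE -[RHS](sup_itvcc ab) image_comp; congr sup.
rewrite -[RHS]image_id; apply: eq_imagel => t /=.
by rewrite in_itv /= => /andP[at_ _]; apply: normcE; exact: le_trans at_.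
Qed.

Lemma cos_half (t : R) : 2 * cos (t / 2) ^+ 2 = 1 + cos t.
Proof.
rewrite -[t in RHS](@divfK _ 2) ?pnatr_eq0 // mulr_natr cos_mulr2n.
by rewrite mulr_natl addrC subrK.
Qed.

Lemma sin_half (t : R) : 2 * sin (t / 2) ^+ 2 = 1 - cos t.
Proof.
by rewrite sin2cos2 mulrBr cos_half mulr1 mulr2n addrKA.
Qed.

End RealRange.

Theorem corollary3 (R : realType) (n : nat) (M N : 'M[R[i]]_n)
    (M_neq0 : M != 0) (M_proper : (M < (1%:M : 'M[R[i]]_n))%MS)
    (N_neq0 : N != 0) (N_proper : (N < (1%:M : 'M[R[i]]_n))%MS) :
  let theta1 : R := dixmier_angle M N in
  let eta1 : R := dixmier_angle (M^!)%MS (N^!)%MS in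
  numerical_range (proj_ortho M + proj_ortho N) =
    [set t%:C | t in `[2 * sin (eta1 / 2) ^+ 2, 2 * cos (theta1 / 2) ^+ 2]] /\
  numerical_radius (proj_ortho M + proj_ortho N) = 2 * cos (theta1 / 2) ^+ 2.
Proof.
move=> theta1 eta1; rewrite cos_half sin_half.
have n0 : (0 < n)%N.
  by apply: leq_trans (rank_leq_row M); rewrite lt0n mxrank_eq0.
have [a [b [ab WE]]] := numerical_range_hermitian n0 (proj_sum_hermsymmx M N).
have [M'0 N'0] := (ortho_neq0 M_proper, ortho_neq0 N_proper).
have bE : b = 1 + cos theta1.
  exact: numerical_range_max M_neq0 N_neq0 _ _ ab WE.
have aE : a = 1 - cos eta1.
  have ba : 2 - b <= 2 - a by rewrite lerD2l lerN2.
  have := numerical_range_max M'0 N'0 ba (numerical_range_proj_ortho_compl WE).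
  by rewrite -/eta1; lra.
have a0 : 0 <= a by rewrite aE subr_ge0 cos_le1.
by rewrite -aE -bE; split=> //; exact: numerical_radius_itv a0 ab WE.
Qed.
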